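(* Let $k\ge r\ge 2$, $n>2k+1$ and $d\in\{\binom{k}{r-1},\binom{k}{r-1}+1\}$, and let $H$ be a connected $n$-vertex $r$-graph with $\delta_1(H)\ge d$. Suppose $\ell(H)=2k$ and that every longest Berge path $P$ in $H$ (with edges $e_1,\dots,e_{2k}$ and key vertices $v_0,\dots,v_{2k}$) satisfies $|\kappa_0(P)|=|\kappa_{2k}(P)|=k$. Then $d=\binom{k}{r-1}$, and either $S'_r(n,k)\subseteq H\subseteq S_r(n,k)$ (up to isomorphism), or $n=sk+1$ for some integer $s$ and $H\cong S(sK^{(r)}_{k+1},1)$.
   Context: An $r$-graph is a simple $r$-uniform hypergraph; $\delta_1(H)$ is its minimum vertex degree. A Berge path of length $t$ consists of $t+1$ distinct key vertices $v_0,\dots,v_t$ and $t$ distinct edges $e_1,\dots,e_t$ with $\{v_{i-1},v_i\}\subseteq e_i$; $K(P)=\{v_0,\dots,v_t\}$, $E(P)=\{e_1,\dots,e_t\}$. $H$ is connected if every two vertices are joined by a Berge path; $\ell(H)$ is the length of a longest Berge path. For $a\in[0,t]$, $\kappa_a(P)=\{i: v_i\in K(P)\setminus\{v_a\},\ \text{there is } e\in E(H)\setminus E(P)\text{ with } v_a,v_i\in e\}$. $S_r(n,k)$ is the $r$-graph on $A\cup B$ with $|A|=k$, $|B|=n-k$ and edges all $r$-subsets $e$ with $|e\cap B|\le1$; $S'_r(n,k)$ has the edges $e$ with $|e\cap B|=1$. $S(sK^{(r)}_{k+1},1)$ is the $r$-graph on $sk+1$ vertices consisting of $s$ copies of the complete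 $r$-graph $K^{(r)}_{k+1}$ on $k+1$ vertices pairwise sharing exactly one common vertex. *)

(* Defs.v *)
From mathcomp Require Import all_boot.

Set Implicit Arguments.
Unset Strict Implicit.
Unset Printing Implicit Defensive.

(* A hypergraph on the vertex type V is its edge set E : {set {set V}};
   edges are sets and E is a set, so there are no repeated edges. *)
Section Hypergraph.

Variable V : finType.
Implicit Types (E : {set {set V}}) (t : nat).

Definition uniform (r : nat) E := forall e, e \in E -> #|e| = r.

Definition degree E (x : V) : nat := #|[set e in E | x \in e]|.

(* The default value #|E| bounds every degree, so for nonempty V this is the
   minimum of the degrees. *)
Definition min_degree E : nat := \big[minn/#|E|]_(x : V) degree E x.

(* The edge of index i : 'I_t (that is, e_{i+1} in the usual 1-based numbering)
   joins the key vertices of indices i and i+1. *)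
Definition berge_path E t
    (v : {ffun 'I_t.+1 -> V}) (e : {ffun 'I_t -> {set V}}) : bool :=
  [&& injectiveb v, injectiveb e &
      [forall i : 'I_t, [&& e i \in E,
                            v (widen_ord (leqnSn t) i) \in e i &
                            v (lift ord0 i) \in e i]]].

Definition key_vertices t (v : {ffun 'I_t.+1 -> V}) : {set V} :=
  [set v i | i : 'I_t.+1].

Definition path_edges t (e : {ffun 'I_t -> {set V}}) : {set {set V}} :=
  [set e i | i : 'I_t].

Definition connected E : Prop :=
  forall x y : V, exists (t : nat) (v : {ffun 'I_t.+1 -> V})
    (e : {ffun 'I_t -> {set V}}),
    [/\ berge_path E v e, v ord0 = x & v ord_max = y].

Definition has_path_of_length E t : bool :=
  [exists v : {ffun 'I_t.+1 -> V}, exists e : {ffun 'I_t -> {set V}},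
     berge_path E v e].

(* The range t < #|V| loses nothing, since a Berge path of length t has t+1
   distinct key vertices; see leq_ell and ell_attained. *)
Definition ell E : nat := \max_(t < #|V| | has_path_of_length E t) t.

Definition kappa E t (v : {ffun 'I_t.+1 -> V}) (e : {ffun 'I_t -> {set V}})
    (a : 'I_t.+1) : {set 'I_t.+1} :=
  [set i | (v i \in key_vertices v :\ v a) &&
           [exists f in E :\: path_edges e, (v a \in f) && (v i \in f)]].

Lemma leq_ell E t (v : {ffun 'I_t.+1 -> V}) (e : {ffun 'I_t -> {set V}}) :
  berge_path E v e -> t <= ell E.
Proof.
move=> P; have tV : t < #|V|.
  case/and3P: P => /injectiveP inj_v _ _.
  by have := leq_card _ inj_v; rewrite card_ord.
rewrite /ell; apply: (bigop.bigmax_sup (Ordinal tV)) => //.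
by apply/existsP; exists v; apply/existsP; exists e.
Qed.

Lemma ell_attained E : 0 < #|V| -> has_path_of_length E (ell E).
Proof.
move=> V0; have H0 : has_path_of_length E (Ordinal V0).
  have /card_gt0P[x _] := V0.
  apply/existsP; exists [ffun=> x]; apply/existsP; exists [ffun=> set0].
  apply/and3P; split; last by apply/forallP => -[].
    by apply/injectiveP => i j _; rewrite (ord1 i) (ord1 j).
  by apply/injectiveP => -[].
rewrite /ell (bigop.bigmax_eq_arg (Ordinal V0)
  (P := fun t : 'I_#|V| => has_path_of_length E t)) //.
by case: arg_maxnP.
Qed.

End Hypergraph.

Definition relabel (V W : finType) (f : V -> W) (E : {set {set V}}) :
    {set {set W}} := [set f @: (e : {set V}) | e in E].

Definition isomorphic (V W : finType) (E : {set {set V}}) (F : {set {set W}}) :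
  Prop := exists2 f : V -> W, bijective f & relabel f E = F.

Definition complete_on (W : finType) (r : nat) (X : {set W}) : {set {set W}} :=
  [set e : {set W} | (e \subset X) && (#|e| == r)].

(* S_r(n,k) and S'_r(n,k) on the disjoint union of A = 'I_k (left summand) and
   B = 'I_(n - k) (right summand); there are n vertices when k <= n. *)
Definition partB (n k : nat) : {set 'I_k + 'I_(n - k)} :=
  [set inr j | j : 'I_(n - k)].

Definition Sgraph (r n k : nat) : {set {set 'I_k + 'I_(n - k)}} :=
  [set e : {set 'I_k + 'I_(n - k)} | (#|e| == r) && (#|e :&: partB n k| <= 1)].

Definition Sgraph' (r n k : nat) : {set {set 'I_k + 'I_(n - k)}} :=
  [set e : {set 'I_k + 'I_(n - k)} | (#|e| == r) && (#|e :&: partB n k| == 1)].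

(* S(sK^{(r)}_{k+1}, 1): None is the common vertex, and the j-th clique consists
   of None and the k vertices Some (j, i). *)
Definition clique_block (s k : nat) (j : 'I_s) : {set option ('I_s * 'I_k)} :=
  None |: [set Some (j, i) | i : 'I_k].

Definition clique_star (r s k : nat) : {set {set option ('I_s * 'I_k)}} :=
  \bigcup_(j < s) complete_on r (clique_block k j).

(* Main.v *)
Require Import Defs.
From mathcomp Require Import all_boot zify.

Set Implicit Arguments.
Unset Strict Implicit.
Unset Printing Implicit Defensive.

(** Let P = v_0 ... v_2k be a longest Berge path and write N(x) for the set of
    neighbours of x.  Since n > 2k+1, no Berge cycle passes through 2k+1
    vertices, so i+1 in kappa_0(P) excludes i in kappa_2k(P); as both sets have
    k elements, i is in kappa_2k(P) exactly when i+1 is not in kappa_0(P).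
    Hence kappa_2k determines kappa_0.  If a path edge e_i contains v_0,
    rotating P along e_i and then replacing e_i by an edge off P keeps kappa_2k,
    hence kappa_0, and shows that e_i lies in v_0 together with its
    kappa_0-neighbours.  Comparing with the minimum degree, N(v_0) has k
    elements, every (r-1)-subset of N(v_0) forms an edge with v_0, and there are
    no other edges at v_0.

    If v_i is in N(v_0), then v_(i-1) is also an end of a longest path.
    Computing N(v_(i-1)) on the rotated path and using the symmetry of adjacency
    gives, for i >= 2, that v_(i-1) is in N(v_0) iff v_2 is.  So N(v_0) is
    either {v_1, ..., v_k} or the set of the v_i with i odd.  In the first case
    v_0, ..., v_k and v_k, ..., v_2k are cliques meeting in v_k; a path leaving
    v_k into the remaining vertices can be grown to length k by a degree count,
    which produces a further clique through v_k.  In the second case the v_i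
    with i even all have neighbourhood A = N(v_0), and a further vertex adjacent
    to A is again an end of a longest path, hence has neighbourhood A as well. *)

(** * Berge paths and their rotations *)

Section BergePaths.

Variables (V : finType) (E : {set {set V}}).
Implicit Types (t i j : nat) (v : nat -> V) (e : nat -> {set V}).
Implicit Types (f g : {set V}) (F : {set {set V}}).

(* Berge paths with nat-indexed key vertices and edges; only the values v i,
   i <= t, and e i, i < t, matter. *)
Definition bpath t v e : Prop :=
  [/\ forall i j, i <= t -> j <= t -> v i = v j -> i = j,
      forall i j, i < t -> j < t -> e i = e j -> i = j
    & forall i, i < t -> [/\ e i \in E, v i \in e i & v i.+1 \in e i]].

Definition edge_set t e : {set {set V}} := [set e (val i) | i : 'I_t].

(** With [F] the edges of a path this is a vertex form of [kappa], not restricted to key vertices;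
    with [F = set0] it is the ordinary neighbourhood. *)
Definition nbhd F x : {set V} :=
  [set y | (y != x) && [exists f in E :\: F, (x \in f) && (y \in f)]].

Lemma edge_setP t e f :
  reflect (exists2 i, i < t & f = e i) (f \in edge_set t e).
Proof.
apply: (iffP imsetP) => [[i _ ->]|[i lt_it ->]].
  by exists i; first exact: ltn_ord.
by exists (Ordinal lt_it).
Qed.

Lemma nbhdP F x y :
  reflect (y != x /\ exists f, [/\ f \in E, f \notin F, x \in f & y \in f])
          (y \in nbhd F x).
Proof.
rewrite inE; apply: (iffP andP) => [[-> /existsP[f /and3P[]]]|[-> [f []]]].
  by rewrite inE => /andP[fF fE] xf yf; split=> //; exists f.
move=> fE fF xf yf; split=> //; apply/existsP; exists f.
by rewrite !inE fE fF xf yf.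
Qed.

Lemma nbhd_sub F x : nbhd F x \subset nbhd set0 x.
Proof.
apply/subsetP=> y /nbhdP[yx [f [fE _ xf yf]]]; apply/nbhdP; split=> //.
by exists f; rewrite in_set0.
Qed.

Lemma nbhd_sym F x y : (x \in nbhd F y) = (y \in nbhd F x).
Proof.
by apply/nbhdP/nbhdP=> -[xy [f [fE fF xf yf]]]; rewrite eq_sym; split=> //;
   exists f.
Qed.

Lemma edge_sub_nbhd x f : f \in E -> x \in f -> f \subset x |: nbhd set0 x.
Proof.
move=> fE xf; apply/subsetP=> y yf; rewrite in_setU1.
have [//|yx /=] := eqVneq y x; apply/nbhdP; split=> //.
by exists f; rewrite in_set0.
Qed.

Lemma bpath_rev t v e :
  bpath t v e -> bpath t (fun i => v (t - i)) (fun i => e (t - i.+1)).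
Proof.
case=> vI eI P; split=> [i j it jt /vI|i j it jt /eI|i it].
- by move=> H; lia.
- by move=> H; lia.
have [] := P (t - i.+1); first lia.
by move=> ? v1 v2; split=> //; move: v2; rewrite (_ : (t - i.+1).+1 = t - i) //; lia.
Qed.

Lemma edge_set_rev t e : edge_set t (fun i => e (t - i.+1)) = edge_set t e.
Proof.
apply/setP=> f; apply/edge_setP/edge_setP=> -[i it ->].
  by exists (t - i.+1) => //; lia.
exists (t - i.+1); first lia.
by congr e; lia.
Qed.

Lemma bpath_extend t v e f w :
  bpath t v e -> f \in E -> f \notin edge_set t e -> v t \in f -> w \in f ->
  (forall i, i <= t -> w <> v i) ->
  bpath t.+1 (fun i => if i <= t then v i else w)
             (fun i => if i < t then e i else f).
Proof.
move=> [vI eI P] fE fP vf wf wv; split=> [i j it jt|i j it jt|i it].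
- case: ifP => ci; case: ifP => cj; first exact: vI.
  + by move=> H; case: (wv i).
  + by move=> H; case: (wv j).
  by move=> _; lia.
- case: ifP => ci; case: ifP => cj; first exact: eI.
  + by move=> H; case/edge_setP: fP; exists i.
  + by move=> H; case/edge_setP: fP; exists j.
  by move=> _; lia.
case: (ltnP i t) => ci; first by rewrite (ltnW ci); exact: P.
have -> : i = t by lia.
by rewrite leqnn.
Qed.

Lemma bpath_swap t v e i g :
  bpath t v e -> i < t -> g \in E -> g \notin edge_set t e ->
  v i \in g -> v i.+1 \in g -> bpath t v (fun j => if j == i then g else e j).
Proof.
move=> [vI eI P] it gE gP vg vg'; split=> // [a b ha hb|j jt].
  case: eqVneq => [->|na]; case: eqVneq => [->|nb] //; last exact: eI.
    by move=> H; case/edge_setP: gP; exists b.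
  by move=> H; case/edge_setP: gP; exists a.
by case: eqVneq => [->|_] //; exact: P.
Qed.

(** The rotated path is v_i, ..., v_0, v_(i+1), ..., v_t, with [f] joining v_0 to v_(i+1) in place
    of e_i. *)
Definition rot_vertex i v j := v (if j <= i then i - j else j).
Definition rot_edge i f e j :=
  if j < i then e (i - j.+1) else if j == i then f else e j.

Lemma bpath_rot t v e i f :
  bpath t v e -> i < t -> f \in E -> v 0 \in f -> v i.+1 \in f ->
  (forall j, j < t -> j <> i -> e j <> f) ->
  bpath t (rot_vertex i v) (rot_edge i f e).
Proof.
move=> [vI eI P] it fE v0 vi fe; rewrite /rot_vertex /rot_edge.
split=> [a b ha hb /vI|a b ha hb|j jt].
- by case: ifP; case: ifP; lia.
- case: (ltngtP a i) => ca; case: (ltngtP b i) => cb; try lia;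
    try (by move/eI; lia); try (by move=> H; case: (fe _ _ _ H); lia);
    by move=> /esym H; case: (fe _ _ _ H); lia.
case: (ltnP j i) => ci.
  rewrite (ltnW ci); have [] := P (i - j.+1); first lia.
  by move=> ? v1 v2; split=> //; move: v2; rewrite (_ : (i - j.+1).+1 = i - j) //; lia.
case: eqP => [->|ji]; first by rewrite leqnn subnn.
by rewrite (_ : (j <= i) = false); [exact: P|lia].
Qed.

(** Runs once round the cycle 0, ..., t, starting just after [p] and ending at [p]. *)
Definition cyc t p j := if j + p < t then j + p.+1 else j + p - t.

Lemma cyc_le t p j : p <= t -> j <= t -> cyc t p j <= t.
Proof. by rewrite /cyc; case: ifP; lia. Qed.

Lemma cyc_inj t p i j :
  p <= t -> i <= t -> j <= t -> cyc t p i = cyc t p j -> i = j.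
Proof. by rewrite /cyc; case: ifP; case: ifP; lia. Qed.

Lemma cyc_neq t p i : p <= t -> i < t -> cyc t p i <> p.
Proof. by rewrite /cyc; case: ifP; lia. Qed.

Lemma cyc_last t p : cyc t p t = p.
Proof. by rewrite /cyc; case: ifP; lia. Qed.

Lemma cycS t p i : p <= t -> i < t ->
  cyc t p i.+1 = if cyc t p i < t then (cyc t p i).+1 else 0.
Proof.
by rewrite /cyc; case: (ltnP (i.+1 + p) t); case: (ltnP (i + p) t) => *;
   case: ifP; lia.
Qed.

Lemma bpath_cycle t v c p : p <= t ->
  (forall i j, i <= t -> j <= t -> v i = v j -> i = j) ->
  (forall i j, i <= t -> j <= t -> c i = c j -> i = j) ->
  (forall i, i <= t -> [/\ c i \in E, v i \in c i &
                           v (if i < t then i.+1 else 0) \in c i]) ->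
  bpath t (v \o cyc t p) (c \o cyc t p).
Proof.
move=> pt vI cI Pc; split=> [i j it jt /= H|i j it jt /= H|i it /=].
- by apply: (cyc_inj pt it jt); apply: vI H; apply: cyc_le.
- apply: (cyc_inj pt (ltnW it) (ltnW jt)).
  by apply: cI H; apply: cyc_le => //; apply: ltnW.
by rewrite cycS //; apply: Pc; apply: cyc_le => //; lia.
Qed.

End BergePaths.

(** Reversed, the path ends at [v 0]; a vertex of [f] off the path would then extend it. *)
Lemma free_edge_in_keys (V : finType) (E : {set {set V}}) t v e f w :
  (forall v' e', ~ bpath E t.+1 v' e') -> bpath E t v e ->
  f \in E -> f \notin edge_set t e -> v 0 \in f -> w \in f ->
  exists2 i, i <= t & w = v i.
Proof.
move=> maxE P fE fP v0f wf.
have [/existsP[i /eqP ->]|/existsPn no] := boolP [exists i : 'I_t.+1, w == v i].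
  by exists i => //; rewrite -ltnS ltn_ord.
case: (maxE _ _ (@bpath_extend _ _ _ _ _ f w (bpath_rev P) _ _ _ _ _)) => //.
- by rewrite edge_set_rev.
- by rewrite subnn.
move=> i it; have it' : t - i < t.+1 by lia.
by move/eqP; apply/negP; apply: (no (Ordinal it')).
Qed.

(** * Finite counting *)

Lemma sub_card_eq (T : finType) (A B : {set T}) :
  A \subset B -> #|B| <= #|A| -> A = B.
Proof. by move=> AB BA; apply/eqP; rewrite eqEcard AB. Qed.

Lemma leq_self_bin n m : 0 < m < n -> n <= 'C(n, m).
Proof.
elim: n m => [|n IH] [|m] //= mn; rewrite binS.
have [mn'|mn'] := ltnP m.+1 n.
  have := IH m.+1 mn'; have : 0 < 'C(n, m) by rewrite bin_gt0; move: mn'; clear; lia.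
  by clear; lia.
have -> : n = m.+1 by move: mn mn'; clear; lia.
by rewrite binn binSn.
Qed.

(** The true indices are closed under predecessor, hence form an initial segment, whose length is
    the sum. *)
Lemma count_down (a : nat -> bool) m c :
  (forall i, 0 < i < m -> a i -> a i.-1) -> \sum_(i < m) a i = c ->
  c <= m /\ forall i, i < m -> a i = (i < c).
Proof.
elim: m c => [|m IH] c down.
  by rewrite big_ord0 => <-.
rewrite big_ord_recr /=; case: (IH _ _ erefl) => [i im|]; first by apply: down; lia.
set c' := \sum_(_ < _) _ => c'm IHi defc; split; first by case: (a m) defc; lia.
move=> i; rewrite ltnS leq_eqVlt => /orP[/eqP->|im].
  case am: (a m) defc => /= defc; last by rewrite -defc addn0 ltnNge c'm.
  case: (posnP m) => [m0|m0]; first by lia.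
  have := down m; rewrite m0 ltnSn am (IHi m.-1) ?prednK // => /(_ isT isT).
  by lia.
case am: (a m) defc => /= defc; last by rewrite IHi // -defc addn0.
have := down m; rewrite (leq_ltn_trans _ im) // ltnSn am (IHi m.-1); last by lia.
by move=> /(_ isT isT); rewrite IHi //; lia.
Qed.

(** Each pair 2i, 2i+1 holds at most one true index. If all m pairs hold one and the last index is
    false, the choice of the even index propagates backwards from the last pair. *)
Lemma count_alternate (a : nat -> bool) m :
  (forall i, 0 < i < 2 * m -> a i -> ~~ a i.-1) ->
  \sum_(i < 2 * m) a i <= m /\
  (\sum_(i < 2 * m) a i = m -> ~~ a (2 * m).-1 ->
   forall i, i < 2 * m -> a i = ~~ odd i).
Proof.
elim: m => [|m IH] alt; first by rewrite big_ord0.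
have [i im|IH1 IH2] := IH; first by apply: alt; lia.
have alt1 := alt (2 * m).+1; have alt0 := alt (2 * m).
rewrite (_ : 2 * m.+1 = (2 * m).+2) in alt1 alt0 *; last lia.
rewrite !big_ord_recr /=; move: IH1 IH2; set s := \sum_(_ < _) _ => IH1 IH2.
split; first by move: alt1; case: (a (2 * m)); case: (a _.+1); lia.
move=> defs aF i im; have a0 : a (2 * m) by move: defs; case: (a _.+1) aF; case: (a _); lia.
have am : 0 < m -> ~~ a (2 * m).-1 by move=> m0; apply: alt0 => //; lia.
have [->|[->|im']] : i = (2 * m).+1 \/ i = 2 * m \/ i < 2 * m by lia.
- by rewrite (negbTE aF) /= oddM.
- by rewrite a0 oddM.
apply: IH2 => //; first by move: defs; rewrite a0 (negbTE aF); lia.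
by apply: am; lia.
Qed.

(** * Longest paths *)

Section Extremal.

Variables (V : finType) (E : {set {set V}}) (k r : nat).
Implicit Types (i j : nat) (v : nat -> V) (e : nat -> {set V}).
Implicit Types (f g : {set V}).

Hypotheses (r_gt1 : 1 < r) (r_le_k : r <= k).
Hypothesis unifE : uniform r E.
Hypothesis degE : forall x, 'C(k, r.-1) <= degree E x.
Hypothesis bigV : 2 * k + 1 < #|V|.
Hypothesis connE : forall U : {set V}, U != set0 ->
  (forall f x, f \in E -> x \in f -> x \in U -> f \subset U) -> U = setT.
Hypothesis maxE : forall v e, ~ bpath E (2 * k).+1 v e.
Hypothesis kapE : forall v e, bpath E (2 * k) v e ->
  #|nbhd E (edge_set (2 * k) e) (v 0)| = k.

Notation long := (bpath E (2 * k)).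
Notation edges := (edge_set (2 * k)).
Notation N := (nbhd E set0).

(* Otherwise the path closes up to a Berge cycle on 2k+1 vertices, and an edge
   leaving its vertex set, on the cycle or not, gives a longer path. *)
Lemma ends_not_joined v e f :
  long v e -> f \in E -> f \notin edges e -> v 0 \in f -> v (2 * k) \notin f.
Proof.
move=> P fE fP v0f; apply/negP=> vkf; have [vI eI Pe] := P.
pose U := [set v (val i) | i : 'I_(2 * k).+1].
have inU i : i <= 2 * k -> v i \in U.
  by move=> it; apply/imsetP; exists (inord i); rewrite //= inordK.
have UT : U = setT.
  apply: connE => [|g x gE xg /imsetP[p0 _ defx]].
    by apply/set0Pn; exists (v 0); apply: inU.
  apply/subsetP=> w wg; apply/negPn/negP=> wU.
  pose c i := if i < 2 * k then e i else f.
  have cI i j : i <= 2 * k -> j <= 2 * k -> c i = c j -> i = j.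
    rewrite /c; case: ltnP => hi; case: ltnP => hj hi' hj' H.
    - exact: eI.
    - by case/edge_setP: fP; exists i.
    - by case/edge_setP: fP; exists j.
    by apply/eqP; rewrite eqn_leq (leq_trans hi' hj) (leq_trans hj' hi).
  (* The cycle is cut open at [p]: at [g] itself if [g] is a cycle edge, otherwise at the position
     [p0] of [x]. The opened path ends in a vertex of [g] and avoids the edge [g]. *)
  have [p [pk vpg gc]] : exists p, [/\ p <= 2 * k, v p \in g &
      forall i, i <= 2 * k -> i <> p -> c i <> g].
    have [/existsP[i /eqP ci]|/existsPn no] := boolP [exists i : 'I_(2 * k).+1, c i == g].
      have ik : i <= 2 * k by rewrite -ltnS ltn_ord.
      exists i; split=> //; last by move=> j jk ji; rewrite -ci => /(cI _ _ jk ik).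
      rewrite -ci /c; case: ltnP => hi; first by have [] := Pe _ hi.
      by have /eqP -> : val i == 2 * k by rewrite eqn_leq ik.
    exists p0; split; [by rewrite -ltnS ltn_ord|by rewrite -defx|].
    move=> i ik _; have ik' : i < (2 * k).+1 by [].
    by apply/eqP; apply: (no (Ordinal ik')).
  have Q : long (v \o cyc (2 * k) p) (c \o cyc (2 * k) p).
    apply: bpath_cycle => // i ik; rewrite /c; case: ltnP => ik'; first exact: Pe.
    by have /eqP -> : i == 2 * k by rewrite eqn_leq ik.
  case: (maxE (@bpath_extend _ _ _ _ _ g w Q _ _ _ _ _)) => //.
  - apply/edge_setP=> -[i ik /=] /esym.
    by apply: gc; [apply: cyc_le => //; apply: ltnW|apply: cyc_neq].
  - by rewrite /= cyc_last.
  move=> i ik wi; move/negP: wU; apply.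
  by rewrite wi /=; apply: inU; apply: cyc_le.
have := leq_imset_card (fun i : 'I_(2 * k).+1 => v (val i)) setT.
rewrite (_ : [set _ | _ in _] = U); last first.
  by apply/setP=> x; apply/imsetP/imsetP => -[i _ ->]; exists i.
by rewrite UT !cardsT card_ord; lia.
Qed.

Lemma nbhd_start v e y : long v e -> y \in nbhd E (edges e) (v 0) ->
  exists2 i, 0 < i < 2 * k & y = v i.
Proof.
move=> P /nbhdP[y0 [f [fE fP v0f yf]]].
have [i ik defy] := free_edge_in_keys maxE P fE fP v0f yf.
exists i => //; have := ends_not_joined P fE fP v0f; rewrite defy in y0 yf.
have [i00|i0] := posnP i; first by rewrite i00 eqxx in y0.
by case: (eqVneq i (2 * k)) => [<-|]; [rewrite yf|lia].
Qed.

Lemma nbhd_end v e y : long v e -> y \in nbhd E (edges e) (v (2 * k)) ->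
  exists2 i, 0 < i < 2 * k & y = v i.
Proof.
move=> P; have := @nbhd_start _ _ y (bpath_rev P).
rewrite edge_set_rev subn0 => H /H[i ik ->].
by exists (2 * k - i) => //; lia.
Qed.

Lemma nbhd_end_card v e : long v e -> #|nbhd E (edges e) (v (2 * k))| = k.
Proof. by move=> /bpath_rev/kapE; rewrite edge_set_rev subn0. Qed.

(** If [f] and [g] witnessed the two memberships, rotating along [f] would give a longest path from
    [v j] to [v (2 * k)] whose ends are joined by [g] off the path. *)
Lemma start_end_disjoint v e j : long v e -> j < 2 * k ->
  v j.+1 \in nbhd E (edges e) (v 0) -> v j \notin nbhd E (edges e) (v (2 * k)).
Proof.
move=> P jk /nbhdP[_ [f [fE fP v0f vjf]]]; apply/negP.
case/nbhdP=> _ [g [gE gP vkg vjg]].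
have gf : g <> f.
  by move=> gf; have := ends_not_joined P fE fP v0f; rewrite -gf vkg.
have Q : long (rot_vertex j v) (rot_edge j f e).
  apply: bpath_rot => // i ik _ eif.
  by case/edge_setP: fP; exists i.
have := ends_not_joined Q gE _ _; rewrite /rot_vertex leq0n subn0.
rewrite [2 * k <= j]leqNgt jk vkg; move=> H; suff: false by []; apply: H => //.
apply/edge_setP=> -[i ik]; rewrite /rot_edge.
case: ifP => c1; last case: ifP => c2 //.
  by move=> H; case/edge_setP: gP; exists (j - i.+1) => //; lia.
by move=> H; case/edge_setP: gP; exists i.
Qed.

(** By [start_end_disjoint] the index sets of the two neighbourhoods, one shifted by one, are
    disjoint among 2k indices; each has k elements, so they are complementary. *)
Lemma free_start_end_compl v e j : long v e -> j < 2 * k ->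
  (v j \in nbhd E (edges e) (v (2 * k))) = (v j.+1 \notin nbhd E (edges e) (v 0)).
Proof.
move=> P jk; have [vI _ _] := P.
set K0 := nbhd E _ (v 0); set K1 := nbhd E _ (v (2 * k)).
pose A := [set i : 'I_(2 * k) | v i.+1 \in K0].
pose B := [set i : 'I_(2 * k) | v i \in K1].
have cA : #|A| = k.
  rewrite -[RHS](kapE P) -/K0 -(card_in_imset (f := fun i : 'I_(2 * k) => v i.+1) (D := A)).
    apply: eq_card => y; apply/imsetP/idP => [[i]|yK]; first by rewrite inE => ? ->.
    have [[|i] ik defy] := nbhd_start P yK; first by [].
    have ik' : i < 2 * k by lia.
    by exists (Ordinal ik') => //; rewrite inE /= -defy.
  by move=> a b _ _ /vI; have := ltn_ord a; have := ltn_ord b => ? ? H; apply/val_inj => /=; lia.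
have cB : #|B| = k.
  rewrite -[RHS](nbhd_end_card P) -/K1 -(card_in_imset (f := fun i : 'I_(2 * k) => v i) (D := B)).
    apply: eq_card => y; apply/imsetP/idP => [[i]|yK]; first by rewrite inE => ? ->.
    have [i ik defy] := nbhd_end P yK.
    have ik' : i < 2 * k by lia.
    by exists (Ordinal ik') => //; rewrite inE /= -defy.
  by move=> a b _ _ /vI; have := ltn_ord a; have := ltn_ord b => ? ? H; apply/val_inj => /=; lia.
have AB : A :&: B = set0.
  apply/setP=> i; rewrite in_setI in_set0 [i \in A]in_set [i \in B]in_set.
  apply/negP=> /andP[iA iB].
  by have := start_end_disjoint P (ltn_ord i) iA; rewrite -/K1 iB.
have ABT : A :|: B = setT.
  apply: sub_card_eq; first exact: subsetT.
  by rewrite cardsU AB cards0 cA cB cardsT card_ord; lia.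
have := in_setT (Ordinal jk); rewrite -ABT in_setU [_ \in A]in_set [_ \in B]in_set /=.
case: (boolP (v j.+1 \in K0)) => [jK _|_ /= ->] //.
by apply/negbTE; apply: start_end_disjoint.
Qed.

(* If g = e i lies on the path, rotating along g keeps the edge set and puts v 0
   just before v i.+1, so complementarity yields an edge h off the path through
   v i and v i.+1; with h in place of g the path is still longest, and its end
   has the same free neighbours, so complementarity gives back the same
   neighbourhood of v 0. *)
Lemma start_edge_sub v e g : long v e -> g \in E -> v 0 \in g ->
  g \subset v 0 |: nbhd E (edges e) (v 0).
Proof.
move=> P gE v0g; have k0 : 0 < 2 * k by lia.
have free v' e' : long v' e' -> v' 0 = v 0 -> g \notin edges e' ->
    g \subset v 0 |: nbhd E (edges e') (v 0).
  move=> P' v'0 gP; apply/subsetP=> y yg; rewrite in_setU1.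
  by have [//|y0] := eqVneq y (v 0); apply/nbhdP; split=> //; exists g.
have [/edge_setP[i ik defg]|gP] := boolP (g \in edges e); last exact: free P _ _.
have [vI eI Pe] := P; have [_ vig vi1g] := Pe _ ik.
have Q : long (rot_vertex i v) (rot_edge i g e).
  by apply: bpath_rot => //; rewrite ?defg // => j jk ji /(eI _ _ jk ik).
have eQ : edges (rot_edge i g e) = edges e.
  apply/setP=> h; apply/edge_setP/edge_setP=> -[j jk]; rewrite /rot_edge.
    case: ifP => c1; last case: eqP => c2.
    - by move=> ->; exists (i - j.+1) => //; lia.
    - by rewrite defg; exists i.
    by exists j.
  move=> ->; have [ji|ij|->] := ltngtP j i.
  - exists (i - j.+1); first lia.
    by rewrite (_ : _ < _); [congr e|]; lia.
  - exists j => //.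
    by rewrite ltnNge (ltnW ij) /= gtn_eqF.
  by exists i; rewrite // ltnn eqxx.
have v0Q := free_start_end_compl Q ik; rewrite /rot_vertex leq0n leqnn subnn ltnn subn0 eQ in v0Q.
rewrite [2 * k <= i]leqNgt ik /= in v0Q.
have : v 0 \notin nbhd E (edges e) (v (2 * k)).
  apply/negP=> /(nbhd_end P)[j jk /vI]; lia.
rewrite v0Q negbK => /nbhdP[_ [h [hE hP vih vi1h]]].
have vkh : v (2 * k) \notin h.
  have := ends_not_joined Q hE; rewrite eQ /rot_vertex leq0n subn0.
  by rewrite [2 * k <= i]leqNgt ik; apply.
have P' := bpath_swap P ik hE hP vih vi1h.
set e' := (fun j => _) in P'.
have gP' : g \notin edges e'.
  apply/edge_setP=> -[j jk]; rewrite /e' defg.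
  case: eqP => [_ H|ji /(eI _ _ ik jk) /esym //].
  by case/edge_setP: hP; exists i.
have vkg := ends_not_joined P' gE gP' v0g.
apply: subset_trans (free _ _ P' erefl gP') _.
apply: setUS; apply/subsetP=> y yK.
have [[|j] jk defy] := nbhd_start P' yK; first by [].
move: yK; rewrite defy => yK.
have jk' : j < 2 * k by move: jk; clear; lia.
have := free_start_end_compl P' jk'; rewrite yK /= => vj.
have := free_start_end_compl P jk'; case: (_ \in nbhd E (edges e) (v 0)) => //= vj'.
case/nbhdP: vj' => vjk [f [fE fP vkf vjf]].
case/nbhdP: vj; split=> //; exists f; split=> //.
apply/edge_setP=> -[l lk]; rewrite /e'; case: eqP => [_ fh|_ fl].
  by rewrite fh (negbTE vkh) in vkf.
by case/edge_setP: fP; exists l.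
Qed.

(** Path edges add no neighbours, so the free neighbourhood of an end does not depend on the path.
    Neighbourhoods computed on different rotations can thus be compared. *)
Lemma start_nbhd v e : long v e -> N (v 0) = nbhd E (edges e) (v 0).
Proof.
move=> P; apply/eqP; rewrite eqEsubset nbhd_sub andbT.
apply/subsetP=> y /nbhdP[y0 [f [fE _ v0f yf]]].
have := subsetP (start_edge_sub P fE v0f) y yf.
by rewrite in_setU1 (negbTE y0).
Qed.

(** * Links of the ends of a longest path *)

Definition full_link x (A : {set V}) :=
  forall T : {set V}, T \subset A -> #|T| = r.-1 -> x |: T \in E.

(** Removing [v 0] from the edges at [v 0] gives distinct (r-1)-subsets of a k-set; the degree is at
    least the number of all such subsets, so every one occurs. *)
Lemma start_link v e : long v e ->
  [/\ #|N (v 0)| = k, full_link (v 0) (N (v 0)) & degree E (v 0) = 'C(k, r.-1)].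
Proof.
move=> P; have cN : #|N (v 0)| = k by rewrite (start_nbhd P) (kapE P).
pose D := [set T : {set V} | T \subset N (v 0) & #|T| == r.-1].
have cD : #|D| = 'C(k, r.-1) by rewrite cards_draws cN.
pose S := [set f in E | v 0 \in f].
have SD : S \subset (fun T : {set V} => v 0 |: T) @: D.
  apply/subsetP=> f; rewrite inE => /andP[fE v0f].
  apply/imsetP; exists (f :\ v 0); last by rewrite setD1K.
  rewrite inE; apply/andP; split.
    by rewrite subDset; exact: edge_sub_nbhd.
  by have := cardsD1 (v 0) f; rewrite v0f (unifE fE); lia.
have cI := leq_imset_card (fun T : {set V} => v 0 |: T) D.
have SE : S = (fun T : {set V} => v 0 |: T) @: D.
  by apply: sub_card_eq => //; apply: leq_trans cI _; rewrite cD; apply: degE.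
split=> // [T TN cT|].
  suff : v 0 |: T \in S by rewrite inE => /andP[].
  by rewrite SE; apply: imset_f; rewrite inE TN cT eqxx.
apply/eqP; rewrite eqn_leq degE andbT -cD.
by apply: leq_trans cI; rewrite -SE.
Qed.

Lemma end_link v e : long v e ->
  #|N (v (2 * k))| = k /\ full_link (v (2 * k)) (N (v (2 * k))).
Proof. by move=> /bpath_rev/start_link[]; rewrite subn0. Qed.

Lemma start_end_compl v e j : long v e -> j < 2 * k ->
  (v j \in N (v (2 * k))) = (v j.+1 \notin N (v 0)).
Proof.
move=> P jk; have := start_nbhd (bpath_rev P).
rewrite edge_set_rev subn0 (start_nbhd P) => ->.
exact: free_start_end_compl.
Qed.

Lemma rot_long v e i : long v e -> i < 2 * k -> v i.+1 \in N (v 0) ->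
  exists e', long (rot_vertex i v) e'.
Proof.
move=> P ik; rewrite (start_nbhd P) => /nbhdP[_ [f [fE fP v0f vif]]].
exists (rot_edge i f e); apply: bpath_rot => // j jk _ ejf.
by case/edge_setP: fP; exists j.
Qed.

Lemma start_count v e : long v e -> \sum_(i < 2 * k) (v i.+1 \in N (v 0)) = k.
Proof.
move=> P; have [cN _ _] := start_link P; have [vI _ _] := P.
rewrite -[RHS]cN -big_mkcond /= sum1_card.
rewrite -(card_in_image (f := fun i : 'I_(2 * k) => v i.+1)); last first.
  move=> a b _ _ /vI H; apply/val_inj/succn_inj/H => //=; exact: ltn_ord.
apply: eq_card => y; apply/imageP/idP => [[i iN ->]|yN] //.
have := yN; rewrite {1}(start_nbhd P) => /(nbhd_start P)[[|i] ik defy] //.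
have ik' : i < 2 * k by move: ik; clear; lia.
by exists (Ordinal ik') => //; rewrite unfold_in /= -defy.
Qed.

(** The rotation starts at [v i] and keeps the end [v (2 * k)], so [N (v (2 * k))] determines which
    path vertices lie in [N (v i)]. *)
Lemma rot_nbhd v e i : long v e -> i < 2 * k -> v i.+1 \in N (v 0) ->
  [/\ #|N (v i)| = k, full_link (v i) (N (v i)) & forall j, j < 2 * k ->
      (rot_vertex i v j.+1 \in N (v i)) = (rot_vertex i v j \notin N (v (2 * k)))].
Proof.
move=> P ik vi; have [e' Q] := rot_long P ik vi.
have [] := start_link Q; rewrite /rot_vertex leq0n subn0 => cN fN _; split=> // j jk.
have := start_end_compl Q jk.
by rewrite /rot_vertex leq0n subn0 [2 * k <= i]leqNgt ik /= => ->; rewrite negbK.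
Qed.

(** On the rotated path [v 0] comes right after [v 1], so [v 0] is adjacent to [v i] iff [v 1] is
    not adjacent to [v (2 * k)]; on the original path this holds iff [v 2] is adjacent to [v 0], a
    condition independent of [i]. *)
Lemma start_nbhd_step v e i : long v e -> 0 < i < 2 * k -> v i.+1 \in N (v 0) ->
  (v i \in N (v 0)) = (v 2 \in N (v 0)).
Proof.
move=> P /andP[i0 ik] vi; have [_ _ H] := rot_nbhd P ik vi.
have k1 : 1 < 2 * k by apply: leq_ltn_trans ik.
have := start_end_compl P k1; have := H i.-1 (leq_ltn_trans (leq_pred i) ik).
rewrite /rot_vertex prednK // leqnn subnn leq_pred nbhd_sym => ->.
by rewrite (_ : i - i.-1 = 1) => [->|]; [rewrite negbK|move: i0; clear; lia].
Qed.

Lemma start_not_end v e : long v e -> v (2 * k) \notin N (v 0).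
Proof.
move=> P; rewrite (start_nbhd P); apply/negP=> /(nbhd_start P)[i ik].
case: P => vI _ _ /vI; move: ik; clear; lia.
Qed.

Lemma start_nbhd_clique v e : long v e -> v 2 \in N (v 0) ->
  forall j, 0 < j <= 2 * k -> (v j \in N (v 0)) = (j <= k).
Proof.
move=> P v2 [//|j] /= jk.
have down i : 0 < i < 2 * k -> v i.+1 \in N (v 0) -> v i.-1.+1 \in N (v 0).
  by case: i => // i ik vi; rewrite /= (start_nbhd_step P ik vi).
by have [_ ->] := @count_down (fun i => v i.+1 \in N (v 0)) _ _ down (start_count P).
Qed.

Lemma start_nbhd_odd v e : long v e -> v 2 \notin N (v 0) ->
  forall j, 0 < j <= 2 * k -> (v j \in N (v 0)) = odd j.
Proof.
move=> P v2 [//|j] /= jk.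
have k0 : 0 < 2 * k by apply: leq_ltn_trans jk.
have alt i : 0 < i < 2 * k -> v i.+1 \in N (v 0) -> v i.-1.+1 \notin N (v 0).
  by case: i => // i ik vi; rewrite /= (start_nbhd_step P ik vi).
(* Index [i] stands for [v i.+1], so even indices are odd-numbered vertices. *)
have [_ ->] // := @count_alternate (fun i => v i.+1 \in N (v 0)) k alt.
  exact: start_count P.
by rewrite prednK // (start_not_end P).
Qed.

(** * Initial-segment neighbourhoods: cliques through one vertex *)

Definition full_linkb x (A : {set V}) :=
  [forall T : {set V}, (T \subset A) && (#|T| == r.-1) ==> (x |: T \in E)].

Lemma full_linkP x A : reflect (full_link x A) (full_linkb x A).
Proof.
apply: (iffP forallP) => [F T TA sT|F T].
  by have := F T; rewrite TA sT eqxx.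
by apply/implyP=> /andP[TA /eqP]; apply: F.
Qed.

(** Since r > 1, every r-subset of [B] contains a vertex other than [c], so [B] spans a complete
    r-graph; an edge leaving [B] can meet it only in [c]. *)
Definition block c (B : {set V}) : Prop :=
  [/\ c \in B, #|B| = k.+1 &
      forall x, x \in B -> x != c -> N x = B :\ x /\ full_link x (B :\ x)].

Definition blockb c (B : {set V}) : bool :=
  [&& c \in B, #|B| == k.+1 &
      [forall x in B, (x != c) ==> (N x == B :\ x) && full_linkb x (B :\ x)]].

Lemma blockP c B : reflect (block c B) (blockb c B).
Proof.
apply: (iffP and3P) => [[cB /eqP sB /forall_inP H]|[cB sB H]]; split=> //.
- by move=> x xB xc; have := H x xB; rewrite xc => /andP[/eqP Nx /full_linkP].
- exact/eqP.
apply/forall_inP=> x xB; apply/implyP=> xc; have [-> /full_linkP F] := H x xB xc.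
by rewrite eqxx.
Qed.

Lemma block_edge_sub c B f x : block c B -> f \in E -> x \in f -> x \in B ->
  x != c -> f \subset B.
Proof.
move=> [_ _ HB] fE xf xB xc; have [Nx _] := HB x xB xc.
by have := edge_sub_nbhd fE xf; rewrite Nx setD1K.
Qed.

(** [N (v (2 * k))] misses [v 0], ..., [v k.-1]. On the path rotated to start at [v i], every other
    vertex of the segment directly follows one of these, so it is adjacent to [v i]; cardinalities
    give equality. *)
Lemma clique_left v e : long v e -> v 2 \in N (v 0) ->
  block (v k) [set v (val i) | i : 'I_k.+1].
Proof.
move=> P v2; have Nv0 := start_nbhd_clique P v2; have [vI _ _] := P.
set B := [set _ | _ in _].
have kk : k <= 2 * k by clear; lia.
have BP y : reflect (exists2 i, i <= k & y = v i) (y \in B).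
  apply: (iffP imsetP) => [[i _ ->]|[i ik ->]]; first by exists i => //; rewrite -ltnS ltn_ord.
  by exists (inord i); rewrite //= inordK.
have cB : #|B| = k.+1.
  rewrite card_imset ?card_ord // => a b /vI H; apply/val_inj/H.
    by apply: leq_trans kk; rewrite -ltnS ltn_ord.
  by apply: leq_trans kk; rewrite -ltnS ltn_ord.
split=> //; first by apply/BP; exists k.
move=> x xB; have [i ik ->] := BP _ xB => ic.
have {}ik : i < k by rewrite ltn_neqAle ik andbT; apply: contraNneq ic => ->.
have ik2 : i < 2 * k by apply: leq_trans kk.
have vi1 : v i.+1 \in N (v 0) by rewrite Nv0.
have [cN fN H] := rot_nbhd P ik2 vi1.
suff -> : B :\ v i = N (v i) by [].
apply: sub_card_eq; last first.
  have := cardsD1 (v i) B; rewrite cB cN (_ : v i \in B); last first.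
    by apply/BP; exists i => //; exact: ltnW.
  by rewrite add1n => -[<-].
have far j : 0 < j.+1 <= k -> v j \notin N (v (2 * k)).
  move=> jk; rewrite (start_end_compl P) ?Nv0 ?negbK; move: jk; clear; lia.
apply/subsetP=> y; rewrite in_setD1 => /andP[yi /BP[j jk defy]].
rewrite defy in yi *.
have [ji|ij|ji] := ltngtP j i; last by rewrite ji eqxx in yi.
  have := H (i - j.+1); rewrite /rot_vertex.
  rewrite (_ : i - j.+1 < i); last by move: ji; clear; lia.
  rewrite (_ : i - j.+1 <= i); last by move: ji; clear; lia.
  rewrite (_ : i - (i - j.+1).+1 = j); last by move: ji; clear; lia.
  rewrite (_ : i - (i - j.+1) = j.+1); last by move: ji; clear; lia.
  move=> ->; last by move: ji ik; clear; lia.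
  by apply: far; move: ji ik; clear; lia.
have := H j.-1; rewrite /rot_vertex.
rewrite (_ : j.-1 < i = false); last by move: ij; clear; lia.
rewrite (_ : j.-1.+1 = j); last by move: ij; clear; lia.
move=> ->; last by move: ij jk; clear; lia.
by apply: far; case: ifP; move: ij jk ik; clear; lia.
Qed.

Lemma clique_end v e : long v e -> v 2 \in N (v 0) ->
  v (2 * k - 2) \in N (v (2 * k)).
Proof.
move=> P v2; have k2 : 1 < k by apply: leq_trans r_le_k.
rewrite (start_end_compl P); last by move: k2; clear; lia.
by rewrite (start_nbhd_clique P v2); move: k2; clear; lia.
Qed.

Lemma clique_right v e : long v e -> v 2 \in N (v 0) ->
  block (v k) [set v (2 * k - val i) | i : 'I_k.+1].
Proof.
move=> P v2; have := clique_left (bpath_rev P).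
rewrite subn0 (_ : 2 * k - k = k); last by clear; lia.
by apply; exact: clique_end P v2.
Qed.

(* If no edge off the path extends it, the degree of u m forces every r-subset of
   the key vertices containing u m to be an edge, and every path edge to contain
   u m and leave the key vertices; exchanging the last edge then frees it. *)
Lemma grow_path (U : {set V}) c m u e : 2 < r ->
  (forall f x, f \in E -> x \in f -> x \in U -> f \subset c |: U) ->
  0 < m < k -> bpath E m u e -> u 0 = c -> (forall i, 0 < i <= m -> u i \in U) ->
  exists u' e', [/\ bpath E m.+1 u' e', u' 0 = c &
                    forall i, 0 < i <= m.+1 -> u' i \in U].
Proof.
move=> r_gt2 closU /andP[m0 mk] P u0 uU; have [uI eI Pe] := P.
pose B := [set u (val i) | i : 'I_m.+1].
have BP y : reflect (exists2 i, i <= m & y = u i) (y \in B).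
  apply: (iffP imsetP) => [[i _ ->]|[i ik ->]]; first by exists i => //; rewrite -ltnS ltn_ord.
  by exists (inord i); rewrite //= inordK.
have cB : #|B| = m.+1.
  by rewrite card_imset ?card_ord // => a b /uI H; apply/val_inj/H; rewrite -ltnS ltn_ord.
have um : u m \in U by apply: uU; rewrite m0 leqnn.
have umB : u m \in B by apply/BP; exists m.
have ext e' f : bpath E m u e' -> f \in E -> u m \in f ->
    f \notin edge_set m e' -> ~~ (f \subset B) ->
    exists u' e'', [/\ bpath E m.+1 u' e'', u' 0 = c &
                      forall i, 0 < i <= m.+1 -> u' i \in U].
  move=> P' fE umf fP /subsetPn[w wf wB].
  have wu i : i <= m -> w <> u i by move=> im wi; move/negP: wB; apply; apply/BP; exists i.
  have Q := bpath_extend P' fE fP umf wf wu.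
  do 2!eexists; split; [exact: Q|by []|move=> i /andP[i0 im]].
  case: ifP => im'; first by apply: uU; rewrite i0.
  have := subsetP (closU f _ fE umf um) w wf; rewrite in_setU1 => /orP[/eqP wc|//].
  by case: (wu 0); rewrite // u0.
pose S := [set f in E | u m \in f].
pose Sin := S :&: [set f : {set V} | f \subset B].
pose Sout := S :\: [set f : {set V} | f \subset B].
have [/existsP[f /andP[]]|/existsPn noext] := boolP [exists f in Sout, f \notin edge_set m e].
  by rewrite !inE => /and3P[fB fE umf] fP; apply: ext P fE umf fP fB.
have subS : Sout \subset edge_set m e.
  by apply/subsetP=> f fS; have := noext f; rewrite fS negbK.
have cEm : #|edge_set m e| <= m.
  by apply: leq_trans (leq_imset_card _ _) _; rewrite card_ord.
have cBm : #|B :\ u m| = m by have := cardsD1 (u m) B; rewrite umB cB add1n => -[].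
pose D := [set T : {set V} | T \subset B :\ u m & #|T| == r.-1].
have cD : #|D| = 'C(m, r.-1) by rewrite cards_draws cBm.
have cI := leq_imset_card (fun T : {set V} => u m |: T) D.
have SD : Sin \subset (fun T : {set V} => u m |: T) @: D.
  apply/subsetP=> f; rewrite !inE => /andP[/andP[fE umf] fB].
  apply/imsetP; exists (f :\ u m); last by rewrite setD1K.
  rewrite inE setSD //=.
  by have := cardsD1 (u m) f; rewrite umf (unifE fE) add1n => ->.
have cS : #|Sin| + #|Sout| = #|S| by rewrite cardsID.
have := degE (u m); rewrite /degree -/S -cS => cS'.
(* By Pascal's rule the degree is at least C(k-1,r-1) + C(k-1,r-2), and the second term is at least
   k-1 >= m because 0 < r-2 < k-1. Hence the upper bounds C(m,r-1) and m for the two parts are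
   attained. *)
have [cSin mk1 cSout] : [/\ 'C(m, r.-1) <= #|Sin|, m = k.-1 & m <= #|Sout|].
  have a1 := leq_trans (subset_leq_card SD) cI; rewrite cD in a1.
  have a2 := leq_trans (subset_leq_card subS) cEm.
  have a3 : 'C(m, r.-1) <= 'C(k.-1, r.-1).
    by apply: leq_bin2l; move: mk; clear; lia.
  have a4 : 'C(k, r.-1) = 'C(k.-1, r.-1) + 'C(k.-1, r.-2).
    by move: r_gt2 mk; clear; case: r k => [|[|[|r']]] // [|k'] // _ _; rewrite binS.
  have a5 : k.-1 <= 'C(k.-1, r.-2).
    by apply: leq_self_bin; move: r_gt2 r_le_k; clear; lia.
  by split; move: cS' mk a1 a2 a3 a4 a5; clear; lia.
have SinE : Sin = (fun T : {set V} => u m |: T) @: D.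
  by apply: sub_card_eq => //; apply: leq_trans cI _; rewrite cD.
have SoutE : Sout = edge_set m e by apply: sub_card_eq => //; apply: leq_trans cSout.
have m1 : m.-1 < m by rewrite prednK.
have u1B : u m.-1 \in B :\ u m.
  rewrite in_setD1; apply/andP; split; last by apply/BP; exists m.-1 => //; exact: ltnW.
  by apply/eqP=> /uI; move: m1; clear; lia.
(* [T] completes [u m] and [u m.-1] to an r-set [g] inside [B]. It is an edge by [SinE], and it is
   off the path because all path edges leave [B]. *)
have /card_gt0P[T] : 0 < #|[set T : {set V} | T \subset B :\ u m :\ u m.-1 & #|T| == r.-2]|.
  have c2 : #|B :\ u m :\ u m.-1| = m.-1.
    by have := cardsD1 (u m.-1) (B :\ u m); rewrite u1B cBm add1n => /(congr1 predn)/esym.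
  by rewrite cards_draws c2 bin_gt0; move: mk1 r_gt2 r_le_k; clear; lia.
rewrite inE => /andP[TB /eqP cT].
have gS : u m |: (u m.-1 |: T) \in Sin.
  rewrite SinE; apply: imset_f; rewrite inE subUset sub1set u1B /=.
  rewrite (subset_trans TB (subsetDl _ _)) /= cardsU1 cT.
  rewrite (_ : u m.-1 \notin T) /=.
    by move: r_gt2; clear; lia.
  by apply/negP=> /(subsetP TB); rewrite in_setD1 eqxx.
set g := u m |: _ in gS.
move: gS; rewrite in_setI [g \in S]in_set [g \in [set _ | _]]in_set.
case/andP=> /andP[gE _] gB.
have gP : g \notin edge_set m e.
  by rewrite -SoutE in_setD [g \in [set _ | _]]in_set gB.
have [] := Pe _ m1; rewrite prednK // => elE _ umel.
have Q : bpath E m u (fun j => if j == m.-1 then g else e j).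
  apply: bpath_swap => //; first by rewrite /g !inE eqxx !orbT.
  by rewrite prednK // /g !inE eqxx.
apply: (ext _ (e m.-1) Q) => //.
  apply/edge_setP=> -[j jm]; case: eqP => [_ H|jm1 /eI].
    by case/edge_setP: gP; exists m.-1.
  by move=> /(_ m1 jm) /esym.
have : e m.-1 \in Sout by rewrite SoutE; apply/edge_setP; exists m.-1.
by rewrite in_setD [_ \in [set _ | _]]in_set => /andP[].
Qed.

Lemma path_from (U : {set V}) c w g m : 2 < r ->
  (forall f x, f \in E -> x \in f -> x \in U -> f \subset c |: U) ->
  g \in E -> c \in g -> w \in g -> w \in U -> c \notin U -> m < k ->
  exists u e, [/\ bpath E m.+1 u e, u 0 = c &
                  forall i, 0 < i <= m.+1 -> u i \in U].
Proof.
move=> r_gt2 closU gE cg wg wU cU; elim: m => [|m IH] mk.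
  exists (fun i => if i == 0 then c else w), (fun=> g).
  split=> [|//|[|i] //].
  split=> [[|[|i]] [|[|j]] //= _ _ H|[|i] [|j] //|[|i] //].
    by rewrite H wU in cU.
  by rewrite -H wU in cU.
have [u [e [P u0 uU]]] := IH (ltnW mk).
exact: grow_path r_gt2 closU _ P u0 uU.
Qed.

(** [v 0] is not adjacent to [v (2 * k)], so complementarity yields an edge off the path through
    [v 0] and [v 1]; for r = 2 it would coincide with [e 0]. *)
Lemma long_r_gt2 v e : long v e -> 2 < r.
Proof.
move=> P; rewrite ltn_neqAle r_gt1 andbT; apply/eqP=> r2.
have k0 : 0 < 2 * k by move: r_le_k r_gt1; clear; lia.
have := start_end_compl P k0.
have -> : (v 0 \in N (v (2 * k))) = false.
  by rewrite nbhd_sym; apply: negbTE; apply: start_not_end P.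
move=> /esym/negbFE; rewrite (start_nbhd P) => /nbhdP[v10 [f [fE fP v0f v1f]]].
case: P => _ _ /(_ 0 k0)[e0E v0e v1e].
have pair h : h \in E -> v 0 \in h -> v 1 \in h -> h = [set v 0; v 1].
  move=> hE h0 h1; apply/esym; apply: sub_card_eq; first by rewrite subUset !sub1set h0.
  by rewrite cards2 eq_sym v10 (unifE hE) -r2.
case/edge_setP: fP; exists 0 => //.
by rewrite (pair f) // (pair (e 0)).
Qed.

(** Let [U] be the uncovered vertices. If [U] is nonempty, connectivity gives an edge from [c] into
    [U], from which a path of length k grows in [c |: U]. Appended to the right half of the given
    path read backwards, it forms a longest path, whose new half is a block at [c] meeting [U]. *)
Lemma clique_cover v e : long v e -> v 2 \in N (v 0) ->
  forall x, x != v k -> exists2 B, block (v k) B & x \in B.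
Proof.
move=> P v2; set c := v k.
pose U := [set x | (x != c) && [forall B, blockb c B ==> (x \notin B)]].
have notU B x : block c B -> x \in B -> x \notin U.
  move=> /blockP bB xB; rewrite inE negb_and; apply/orP; right.
  by apply/forallPn; exists B; rewrite bB xB.
have cU : c \notin U by rewrite inE eqxx.
suff U0 : U = set0.
  move=> x xc; have := in_set0 x; rewrite -U0 inE xc /= => /negbT/forallPn[B].
  by rewrite negb_imply negbK => /andP[/blockP bB xB]; exists B.
apply/eqP; apply: contraNT cU => Un0.
have closU f x : f \in E -> x \in f -> x \in U -> f \subset c |: U.
  move=> fE xf xU; apply/subsetP=> y yf; rewrite in_setU1.
  have [//|yc /=] := eqVneq y c; rewrite inE yc; apply/forallP=> B.
  apply/implyP=> /blockP bB; apply: contraL xU => yB.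
  by apply: (notU _ _ bB); apply: (subsetP (block_edge_sub bB fE yf yB yc)).
have [/existsP[g /and3P[gE cg /set0Pn[w]]]|/existsPn no] :=
    boolP [exists g in E, (c \in g) && (g :&: U != set0)]; last first.
  rewrite (connE Un0) ?inE // => f x fE xf xU.
  have := closU f x fE xf xU; apply: contraTT => fU.
  apply/subsetPn; have := no f; rewrite fE /= negb_and => /orP[cf|].
    case/subsetPn: fU => y yf yU; exists y => //; rewrite in_setU1 (negbTE yU) orbF.
    by apply: contraNneq cf => <-.
  by rewrite negbK => /eqP/setP/(_ x); rewrite !in_setI xf xU in_set0.
rewrite in_setI => /andP[wg wU].
have k0 : k.-1 < k by move: r_gt1 r_le_k; clear; lia.
have cU' : c \notin U by rewrite inE eqxx.
have [u [e' [Pu u0 uU]]] := path_from (long_r_gt2 P) closU gE cg wg wU cU' k0.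
rewrite prednK in Pu uU; last by apply: leq_ltn_trans k0.
have bR := clique_right P v2.
have [vI eI Pe] := P; have [uI e'I Pe'] := Pu.
have vR i : i <= k -> v (2 * k - i) \in [set v (2 * k - val i) | i : 'I_k.+1].
  by move=> ik; apply/imsetP; exists (inord i); rewrite //= inordK.
have vU i : i <= k -> v (2 * k - i) \notin U by move=> ik; exact: notU bR (vR i ik).
pose w' i := if i <= k then v (2 * k - i) else u (i - k).
pose d i := if i < k then e (2 * k - i.+1) else e' (i - k).
(* The edge of the old path contains a vertex other than [c] outside [U], whereas the edges of the
   new one stay inside [c |: U]. *)
have ee' i j : i < k -> j < k -> e (2 * k - i.+1) <> e' j.
  move=> ik jk H; have [] := Pe (2 * k - i.+1); first by move: ik; clear; lia.
  rewrite (_ : (2 * k - i.+1).+1 = 2 * k - i); last by move: ik; clear; lia.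
  rewrite H => _ _ vie; have [eE _ ue] := Pe' _ jk.
  have := subsetP (closU _ _ eE ue _) _ vie.
  rewrite in_setU1 (negbTE (vU i (ltnW ik))) orbF => H'.
  have /eqP/vI : v (2 * k - i) == v k by apply: H'; apply: uU.
  by move: ik; clear; lia.
have Q : long w' d.
  split=> [i j ik jk|i j ik jk|i ik]; rewrite /w' /d.
  - case: (leqP i k) => hi; case: (leqP j k) => hj.
    + by move/vI; move: hi hj; clear; lia.
    + move=> H; have := vU i hi; rewrite H uU //.
      by move: jk hj; clear; lia.
    + move=> H; have := vU j hj; rewrite -H uU //.
      by move: ik hi; clear; lia.
    by move/uI; move: hi hj ik jk; clear; lia.
  - case: (ltnP i k) => hi; case: (ltnP j k) => hj.
    + by move/eI; move: hi hj; clear; lia.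
    + by move/ee'; case => //; move: hj jk; clear; lia.
    + by move/esym/ee'; case => //; move: hi ik; clear; lia.
    by move/e'I; move: hi hj ik jk; clear; lia.
  case: (ltnP i k) => hi.
    rewrite (ltnW hi); have [] := Pe (2 * k - i.+1); first by move: hi; clear; lia.
    by rewrite (_ : (2 * k - i.+1).+1 = 2 * k - i); last by move: hi; clear; lia.
  rewrite (_ : (if i <= k then v (2 * k - i) else u (i - k)) = u (i - k)).
    by rewrite subSn //; apply: Pe'; move: ik hi; clear; lia.
  case: leqP => // ik'; rewrite (_ : i = k); last by move: ik' hi; clear; lia.
  by rewrite subnn u0 /c; congr v; clear; lia.
have w'2 : w' 2 \in N (w' 0).
  have k2 : 1 < k by move: r_gt1 r_le_k; clear; lia.
  by rewrite /w' k2 subn0; apply: clique_end P v2.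
have := clique_right Q w'2; rewrite {1}/w' leqnn (_ : 2 * k - k = k); last by clear; lia.
move=> bQ; have : w' k.+1 \in U.
  by rewrite /w' ltnn subSnn uU // (leq_ltn_trans _ k0).
suff wB : w' k.+1 \in [set w' (2 * k - val i) | i : 'I_k.+1].
  by rewrite (negbTE (notU _ _ bQ wB)).
apply/imsetP; exists (inord k.-1) => //=; rewrite inordK; last by move: k0; clear; lia.
by congr w'; move: k0; clear; lia.
Qed.

(** * Alternating neighbourhoods: even-numbered vertices share one neighbourhood *)

Lemma start_nbhd_oddP v e y : long v e -> v 2 \notin N (v 0) ->
  reflect (exists2 i, odd i && (i < 2 * k) & y = v i) (y \in N (v 0)).
Proof.
move=> P v2; have No := start_nbhd_odd P v2.
apply: (iffP idP) => [yN|[i /andP[io ik] ->]]; last first.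
  by rewrite No //; case: i io ik => // i _ /ltnW.
have := yN; rewrite {1}(start_nbhd P) => /(nbhd_start P)[i ik defy].
exists i => //; rewrite -(No i) -?defy ?yN; by case/andP: ik => // -> /ltnW.
Qed.

Lemma end_nbhd_odd v e j : long v e -> v 2 \notin N (v 0) -> j < 2 * k ->
  (v j \in N (v (2 * k))) = odd j.
Proof.
by move=> P v2 jk; rewrite (start_end_compl P) // (start_nbhd_odd P) //= negbK.
Qed.

(** For i < 2k, rotate so that [v i] comes first. Every odd-numbered vertex then directly follows an
    even-numbered one, which is not in [N (v (2 * k))], so it is adjacent to [v i]; cardinalities
    give equality. *)
Lemma even_attached v e i : long v e -> v 2 \notin N (v 0) ->
  i <= 2 * k -> ~~ odd i -> N (v i) = N (v 0) /\ full_link (v i) (N (v 0)).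
Proof.
move=> P v2 ik io; have [cN _ _] := start_link P.
suff [cNi fi sub] : [/\ #|N (v i)| = k, full_link (v i) (N (v i)) &
                        N (v 0) \subset N (v i)].
  by have E0i : N (v 0) = N (v i); [apply: sub_card_eq => //; rewrite cN cNi|rewrite E0i].
move: ik; rewrite leq_eqVlt => /orP[/eqP ->|ik].
  have [cNk fk] := end_link P; split=> //.
  apply/subsetP=> y /(start_nbhd_oddP _ P v2)[j /andP[jo jk] ->].
  by rewrite (end_nbhd_odd P).
have vi : v i.+1 \in N (v 0) by rewrite (start_nbhd_odd P).
have [cNi fi H] := rot_nbhd P ik vi; split=> //.
apply/subsetP=> y /(start_nbhd_oddP _ P v2)[j /andP[jo jk] ->].
pose l := if j <= i then i - j.+1 else j.-1.
have := H l; rewrite /rot_vertex.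
have -> : (if l < i then i - l.+1 else l.+1) = j.
  by rewrite /l; case: (leqP j i) => ji; case: ifP; move: io jo ji; clear; lia.
move=> ->; last by rewrite /l; case: ifP; move: ik jk; clear; lia.
rewrite (end_nbhd_odd P) //; rewrite /l; case: (leqP j i) => ji; case: ifP;
  by move: io jo ji ik jk; clear; lia.
Qed.

(** Replacing [v 0] by [u] gives a longest path from [u] to an even-numbered vertex. On it every
    odd-numbered vertex directly follows [u] or an even-numbered vertex, neither in [N (v 0)], so
    complementarity puts it in [N u]. *)
Lemma odd_attach v e g u a : long v e -> v 2 \notin N (v 0) ->
  g \in E -> u \in g -> a \in g -> u \notin N (v 0) ->
  (forall i, i <= 2 * k -> u <> v i) -> a \in N (v 0) ->
  N u = N (v 0) /\ full_link u (N (v 0)).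
Proof.
move=> P v2 gE ug ag uA uv aA; have [vI eI Pe] := P.
(* An even-numbered vertex in [g] would put its neighbour [u] in [N (v 0)]. Every path edge contains
   an even-numbered vertex, so [g] is off the path. *)
have gv i : i <= 2 * k -> ~~ odd i -> v i \notin g.
  move=> ik io; apply: contra uA => vig; have [<- _] := even_attached P v2 ik io.
  by have := subsetP (edge_sub_nbhd gE vig) u ug; rewrite in_setU1 => /orP[/eqP/(uv i ik)|].
have ge j : j < 2 * k -> g <> e j.
  move=> jk gej; have [_ vj vj1] := Pe j jk.
  case jo : (odd j).
    by have := gv j.+1 jk; rewrite /= jo /= gej vj1 => /(_ isT).
  by have := gv j (ltnW jk); rewrite jo gej vj => /(_ isT).
have [i /andP[io ik] defa] := start_nbhd_oddP _ P v2 aA.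
have k2 : 1 < 2 * k by apply: leq_trans ik; case: (i) io.
(* The edge [h], off the path, leads from [v (2 * k)] back to [v 1]. *)
have := end_nbhd_odd P v2 k2; have := start_nbhd (bpath_rev P).
rewrite edge_set_rev subn0 => -> /nbhdP[_ [h [hE hP vkh v1h]]].
have gh : g <> h by move=> gh; have := gv (2 * k) (leqnn _); rewrite gh vkh oddM => /(_ isT).
have he j : j < 2 * k -> h <> e j by move=> jk hej; case/edge_setP: hP; exists j.
(* The new path is u, v i, ..., v (2k), v 1, ..., v i.-1. *)
pose ix j := if i + j <= (2 * k).+1 then (i + j).-1 else i + j - (2 * k).+1.
pose w j := if j == 0 then u else v (ix j).
pose d j := if j == 0 then g else if i + j <= 2 * k then e (i + j).-1 else
            if i + j == (2 * k).+1 then h else e (i + j - (2 * k).+1).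
have i0 : 0 < i by case: (i) io.
have ixk j : j <= 2 * k -> ix j <= 2 * k.
  by move=> jk; rewrite /ix; case: ifP; move: ik jk; clear; lia.
have Q : long w d.
  split=> [a1 a2 h1 h2|a1 a2 h1 h2|j jk].
  - rewrite /w; case: eqP => n1; case: eqP => n2; first by rewrite n1.
    + by move=> H; case: (uv _ _ H); apply: ixk.
    + by move=> /esym H; case: (uv _ _ H); apply: ixk.
    move/vI; move/(_ (ixk _ h1) (ixk _ h2)); rewrite /ix.
    by case: ifP; case: ifP; move: n1 n2 i0 ik h1 h2; clear; lia.
  - rewrite /d; case: (a1 =P 0) => n1; case: (a2 =P 0) => n2; first by rewrite n1.
    + case: ifP => c1; first by move=> H; case: (ge _ _ H); move: c1 i0; clear; lia.
      case: ifP => c2; first by move/gh.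
      by move=> H; case: (ge _ _ H); move: c1 c2 h2 ik; clear; lia.
    + case: ifP => c1; first by move=> /esym H; case: (ge _ _ H); move: c1 i0; clear; lia.
      case: ifP => c2; first by move/esym/gh.
      by move=> /esym H; case: (ge _ _ H); move: c1 c2 h1 ik; clear; lia.
    case: (leqP (i + a1) (2 * k)) => b1; last case: (i + a1 =P _) => b1';
      (case: (leqP (i + a2) (2 * k)) => b2; last case: (i + a2 =P _) => b2');
      try (by move/eI; move: n1 n2 b1 b2 i0 ik h1 h2; clear; lia);
      try (by move/eI; move: n1 n2 b1 b2 b1' b2' i0 ik h1 h2; clear; lia);
      try (by move=> H; case: (he _ _ H); move: n1 n2 b1 b2 i0 ik h1 h2; clear; lia);
      try (by move=> H; case: (he _ _ H); move: n1 n2 b1 b2 b1' b2' i0 ik h1 h2; clear; lia);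
      try (by move=> /esym H; case: (he _ _ H); move: n1 n2 b1 b2 i0 ik h1 h2; clear; lia);
      try (by move=> /esym H; case: (he _ _ H); move: n1 n2 b1 b2 b1' b2' i0 ik h1 h2; clear; lia);
      by move: b1 b2 b1' b2'; clear; lia.
  rewrite /w /d /ix; case: eqP => [->|j0] /=.
    by rewrite addn1 /= (leq_trans ik) // -defa.
  rewrite addnS; case: (leqP (i + j) (2 * k)) => b1.
    rewrite ltnS b1 leqW //= -{4}(@prednK (i + j)); last by rewrite addn_gt0 i0.
    by apply: Pe; move: b1 i0; clear; lia.
  rewrite [i + j < _](_ : _ = false); last by move: b1; clear; lia.
  case: eqP => [b2|b2].
    rewrite b2 leqnn /= (_ : (2 * k).+2 - (2 * k).+1 = 1); last by clear; lia.
    by [].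
  rewrite [i + j <= _](_ : _ = false); last by move: b1 b2; clear; lia.
  by rewrite subSn; [apply: Pe; move: jk ik; clear; lia|move: b1; clear; lia].
have ix_even j : j <= 2 * k -> ~~ odd j -> ~~ odd (ix j).
  by move=> jk jo; rewrite /ix; case: ifP; move: i0 io jk jo; clear; lia.
have Nw : N (w (2 * k)) = N (v 0).
  rewrite /w (_ : _ == _ = false); last by move: k2; clear; lia.
  by have [] // := even_attached P v2 (ixk _ (leqnn _)) (ix_even _ (leqnn _) _); rewrite oddM.
have [cNu fu _] := start_link Q; have [cN _ _] := start_link P.
rewrite {1 2 3}/w /= in cNu fu.
suff -> : N (v 0) = N u by [].
apply: sub_card_eq; last by rewrite cN cNu.
apply/subsetP=> y /(start_nbhd_oddP _ P v2)[l /andP[lo lk] ->].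
pose j := if i <= l then l - i else l + 2 * k - i.
have jk : j < 2 * k by rewrite /j; case: ifP; move: ik lk i0; clear; lia.
have jo : ~~ odd j by rewrite /j; case: ifP; move: io lo ik; clear; lia.
have <- : ix j.+1 = l.
  by rewrite /ix /j; case: (leqP i l); case: ifP; move: ik lk i0 io lo; clear; lia.
have := start_end_compl Q jk; rewrite Nw {2 3}/w /= => H.
apply: negbFE; rewrite -H /w; case: eqP => j0; first exact: negbTE.
rewrite (start_nbhd_odd P v2); first by apply: negbTE; apply: ix_even => //; exact: ltnW.
rewrite (ixk _ (ltnW jk)) andbT /ix; case: ifP; move: j0 i0; clear; lia.
Qed.

(** Let [U] collect the vertices outside [A] that violate the claim. No edge leaves [U]: a vertex of
    [A] on it is excluded by [odd_attach], and a vertex outside both sets has neighbourhood [A]. As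
    [v 0] is not in [U], connectivity makes [U] empty. *)
Lemma odd_cover v e : long v e -> v 2 \notin N (v 0) ->
  forall x, x \notin N (v 0) -> N x = N (v 0) /\ full_link x (N (v 0)).
Proof.
move=> P v2; set A := N (v 0).
pose U := [set x | (x \notin A) && ~~ ((N x == A) && full_linkb x A)].
have notU x : N x = A /\ full_link x A -> x \notin U.
  by case=> Nx /full_linkP fx; rewrite inE Nx eqxx fx andbF.
suff U0 : U = set0.
  move=> x xA; have := in_set0 x; rewrite -U0 inE xA /= => /negbFE/andP[/eqP-> /full_linkP].
  by [].
apply/eqP; apply/negPn/negP=> Un0.
have k0 : 0 <= 2 * k by [].
have := notU _ (even_attached P v2 k0 isT).
rewrite (connE Un0) ?in_setT // => f x fE xf xU; apply/subsetP=> y yf.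
have := xU; rewrite inE => /andP[xA nx]; apply/negPn/negP=> yU.
have xv i : i <= 2 * k -> x <> v i.
  move=> ik xi; case io : (odd i).
    by rewrite xi /A (start_nbhd_odd P v2) ?io // in xA; case: (i) io ik.
  by have := notU _ (even_attached P v2 ik (negbT io)); rewrite -xi xU.
have [yA|yA] := boolP (y \in A).
  by have := notU x (odd_attach P v2 fE xf yf xA xv yA); rewrite xU.
have := yU; rewrite inE yA /= negbK => /andP[/eqP Ny _].
have := subsetP (edge_sub_nbhd fE yf) x xf; rewrite in_setU1 Ny (negbTE xA) orbF.
by move=> /eqP xy; rewrite -xy xU in yU.
Qed.

Lemma extremal_structure v e : long v e ->
  (exists2 A : {set V}, #|A| = k &
     forall x, x \notin A -> N x = A /\ full_link x A) \/
  (exists c, forall x, x != c -> exists2 B, block c B & x \in B).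
Proof.
move=> P; case v2: (v 2 \in N (v 0)).
  by right; exists (v k); apply: clique_cover P v2.
left; exists (N (v 0)); first by have [] := start_link P.
by apply: odd_cover P _; rewrite v2.
Qed.

End Extremal.

Lemma mem_relabel (V W : finType) (f : V -> W) (g : W -> V)
    (E : {set {set V}}) (X : {set W}) :
  cancel f g -> cancel g f -> (X \in relabel f E) = (g @: X \in E).
Proof.
move=> fK gK; apply/imsetP/idP => [[e eE ->]|gX]; last first.
  by exists (g @: X); rewrite // -imset_comp (eq_imset _ gK) imset_id.
by rewrite -imset_comp (eq_imset _ fK) imset_id.
Qed.

(** * The extremal hypergraphs *)

Section Isomorphisms.

Variables (V : finType) (E : {set {set V}}) (k r : nat).
Hypotheses (r_gt1 : 1 < r) (unifE : uniform r E).

Notation N := (nbhd E set0).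

Lemma full_link_edge x (A X : {set V}) :
  full_link E r x A -> x \in X -> X :\ x \subset A -> #|X| = r -> X \in E.
Proof.
move=> F xX XA sX; rewrite -(setD1K xX); apply: F => //.
by have := cardsD1 x X; rewrite xX sX add1n => ->.
Qed.

(** An edge through a vertex [x] outside [A] lies in [x |: A], so it has only one vertex outside
    [A]; conversely [full_link] supplies every r-set with exactly one such vertex. *)
Lemma split_iso (A : {set V}) : #|A| = k ->
  (forall x, x \notin A -> N x = A /\ full_link E r x A) ->
  exists2 f : V -> 'I_k + 'I_(#|V| - k), bijective f &
    (Sgraph' r #|V| k \subset relabel f E) &&
    (relabel f E \subset Sgraph r #|V| k).
Proof.
move=> cA HA; have cAC : #|~: A| = #|V| - k by rewrite cardsCs setCK cA.
pose g (z : 'I_k + 'I_(#|V| - k)) : V := match z with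
  | inl i => enum_val (cast_ord (esym cA) i)
  | inr j => enum_val (cast_ord (esym cAC) j) end.
have gA z : (g z \in A) = (z \notin partB #|V| k).
  case: z => i /=; rewrite /partB.
    rewrite enum_valP; apply/esym/negP=> /imsetP[j _] //.
  have := enum_valP (cast_ord (esym cAC) i); rewrite in_setC => /negbTE ->.
  by apply/esym/negbF/imsetP; exists i.
have gI : injective g.
  move=> z1 z2 H; have := gA z1; have := gA z2; rewrite H => ->.
  case: z1 z2 H => [i|i] [j|j] //= /[swap] _ H.
  - by move/enum_val_inj: H => /cast_ord_inj ->.
  - by have := enum_valP (cast_ord (esym cAC) j); rewrite -H in_setC enum_valP.
  - by have := enum_valP (cast_ord (esym cAC) i); rewrite H in_setC enum_valP.
  by move/enum_val_inj: H => /cast_ord_inj ->.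
have kV : k <= #|V| by rewrite -cA max_card.
have [|f gK fK] := @inj_card_bij _ _ g gI.
  by rewrite card_sum !card_ord subnKC.
have cX (X : {set 'I_k + 'I_(#|V| - k)}) : #|X :&: partB #|V| k| = #|g @: X :\: A|.
  rewrite -(card_imset _ gI); apply: eq_card => y.
  apply/imsetP/setDP => [[z /setIP[zX zB] ->]|[/imsetP[z zX ->]]].
    by rewrite imset_f // gA zB.
  by rewrite gA negbK => zB; exists z; rewrite // inE zX.
exists f; first by exists g.
apply/andP; split; apply/subsetP=> X.
  rewrite inE (mem_relabel _ _ fK gK) cX => /andP[/eqP sX /cards1P[x xE]].
  have : x \in g @: X :\: A by rewrite xE set11.
  rewrite inE => /andP[xA xX]; have [_ F] := HA x xA.
  apply: full_link_edge F xX _ _; last by rewrite card_imset.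
  apply/subsetP=> y; rewrite in_setD1 => /andP[yx yX].
  apply: contraNT yx => yA; rewrite -in_set1 -xE inE yA yX //.
rewrite (mem_relabel _ _ fK gK) inE cX => gE.
rewrite -(card_imset _ gI) (unifE gE) eqxx /=.
apply/card_le1_eqP => x y /setDP[xX xA] /setDP[yX yA].
have := subsetP (edge_sub_nbhd gE xX) y yX; have [-> _] := HA x xA.
by rewrite in_setU1 (negbTE yA) orbF => /eqP.
Qed.

(** The block of a vertex [x] other than [c] is [x |: N x], so distinct blocks share only [c].
    Numbering the blocks, and the vertices other than [c] in each, gives the isomorphism. *)
Lemma star_iso c :
  0 < k -> (forall x, x != c -> exists2 B, block E k r c B & x \in B) ->
  exists2 s, #|V| = s * k + 1 & isomorphic E (clique_star r s k).
Proof.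
move=> k0 Hc; pose b x := x |: N x.
have bE B x : block E k r c B -> x \in B -> x != c -> b x = B.
  by case=> _ _ HB xB xc; have [Nx _] := HB x xB xc; rewrite /b Nx setD1K.
have bB x : x != c -> block E k r c (b x).
  by move=> xc; have [B HB xB] := Hc x xc; rewrite (bE B).
pose Bs := b @: [set~ c]; pose s := #|Bs|.
pose D (j : 'I_s) : {set V} := enum_val j.
have DB j : block E k r c (D j).
  by have /imsetP[x] := enum_valP j; rewrite in_setC1 /D => xc ->; apply: bB.
have cD j : size (enum (D j :\ c)) = k.
  have [cDj sD _] := DB j; rewrite -cardE.
  by have := cardsD1 c (D j); rewrite cDj sD add1n => -[].
(* The default [c] of [nth] is never reached: each list has k entries by [cD]. *)
pose h (z : option ('I_s * 'I_k)) : V :=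
  if z is Some (j, i) then nth c (enum (D j :\ c)) i else c.
have hD j i : h (Some (j, i)) \in D j :\ c.
  by rewrite /= -mem_enum mem_nth // cD.
have bh j i : b (h (Some (j, i))) = D j.
  by have := hD j i; rewrite in_setD1 => /andP[hc hj]; apply: bE (DB j) hj hc.
have hc j i : h (Some (j, i)) != c by have := hD j i; rewrite in_setD1 => /andP[].
have hI : injective h.
  case=> [[j1 i1]|] [[j2 i2]|] // H.
  - have := congr1 b H; rewrite !bh => /enum_val_inj jj; rewrite jj in H *.
    move/eqP: H; rewrite /= nth_uniq ?cD ?enum_uniq // => /eqP/val_inj ->.
    by [].
  - by have := hc j1 i1; rewrite H eqxx.
  by have := hc j2 i2; rewrite -H eqxx.
have hS x : x \in codom h.
  have [->|xc] := eqVneq x c; first exact: (codom_f h None).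
  have bx : b x \in Bs by apply: imset_f; rewrite in_setC1.
  pose j : 'I_s := enum_rank_in bx (b x).
  have Dj : D j = b x by rewrite /D enum_rankK_in.
  have xe : x \in enum (D j :\ c) by rewrite mem_enum Dj in_setD1 xc setU11.
  have ik : index x (enum (D j :\ c)) < k by rewrite -(cD j) index_mem.
  by apply/codomP; exists (Some (j, Ordinal ik)); rewrite /= nth_index.
have cV : #|V| = s * k + 1.
  have <- : #|codom h| = #|V| by apply: eq_card => x; rewrite hS.
  by rewrite card_codom // card_option card_prod !card_ord addn1.
exists s => //; have [|f gK fK] := @inj_card_bij _ _ h hI.
  by rewrite card_option card_prod !card_ord cV addn1.
exists f; first by exists h.
have hblock z j : (z \in clique_block k j) = (h z \in D j).
  rewrite in_setU1; case: z => [[j' i]|] /=; last by case: (DB j) => ->.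
  apply/imsetP/idP => [[i' _ [-> ->]]|hj].
    by have := hD j i'; rewrite in_setD1 => /andP[].
  exists i => //; congr (Some (_, _)); apply: enum_val_inj.
  by rewrite -!/(D _) -(bh j' i) (bE (D j)).
apply/setP=> X; rewrite (mem_relabel _ _ fK gK).
have sX : #|h @: X| = #|X| by rewrite card_imset.
have subD j : (X \subset clique_block k j) = (h @: X \subset D j).
  apply/subsetP/subsetP => [H y /imsetP[z zX ->]|H z zX].
    by rewrite -hblock H.
  by rewrite hblock; apply: H; apply: imset_f.
have noncentral (Y : {set V}) : #|Y| = r -> exists2 x, x \in Y & x != c.
  move=> sY; have /card_gt0P[x] : 0 < #|Y :\ c|.
    by have := cardsD1 c Y; rewrite sY; case: (c \in Y); move: r_gt1; clear; lia.
  by rewrite in_setD1 => /andP[xc xY]; exists x.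
apply/idP/bigcupP => [XE|[j _]].
  have sXr := unifE XE; have [x xX xc] := noncentral _ sXr.
  have bx : b x \in Bs by apply: imset_f; rewrite in_setC1.
  exists (enum_rank_in bx (b x)) => //.
  rewrite inE subD /D enum_rankK_in // -sX sXr eqxx andbT.
  exact: edge_sub_nbhd.
rewrite inE subD -sX => /andP[Xj /eqP sXr].
have [x xX xc] := noncentral _ sXr; have [_ _ HD] := DB j.
have [_ F] := HD x (subsetP Xj x xX) xc.
by apply: full_link_edge F xX _ sXr; apply: setSD.
Qed.

End Isomorphisms.

(** * Passage from the stated notions to the working ones *)

Lemma min_degree_le (V : finType) (E : {set {set V}}) x :
  min_degree E <= degree E x.
Proof.
rewrite /min_degree; have := mem_index_enum x.
elim: (index_enum V) => // y s IH; rewrite inE big_cons => /orP[/eqP->|/IH le].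
  exact: geq_minl.
exact: leq_trans (geq_minr _ _) le.
Qed.

Lemma bpath_berge (V : finType) (E : {set {set V}}) t v e :
  bpath E t v e ->
  berge_path E [ffun i : 'I_t.+1 => v i] [ffun i : 'I_t => e i].
Proof.
case=> vI eI P; apply/and3P; split.
- apply/injectiveP=> i j; rewrite !ffunE => /vI H.
  by apply/val_inj/H; rewrite -ltnS ltn_ord.
- by apply/injectiveP=> i j; rewrite !ffunE => /eI H; apply/val_inj/H; exact: ltn_ord.
apply/forallP=> i; rewrite !ffunE /= /bump leq0n add1n.
by have [-> -> ->] := P i (ltn_ord i).
Qed.

(** [inord] serves the vertices because ['I_t.+1] is inhabited; ['I_t] may be empty, so the edges
    use [insub] with the default [set0]. *)
Lemma berge_bpath (V : finType) (E : {set {set V}}) t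
    (v : {ffun 'I_t.+1 -> V}) (e : {ffun 'I_t -> {set V}}) :
  berge_path E v e ->
  bpath E t (fun i => v (inord i)) (fun i => oapp e set0 (insub i)).
Proof.
case/and3P=> /injectiveP vI /injectiveP eI /forallP P; split=> [i j it jt|i j it jt|i it].
- by move/vI/(congr1 val); rewrite /= !inordK.
- rewrite (insubT (fun m => m < t) it) (insubT (fun m => m < t) jt) /=.
  by move/eI/(congr1 val).
rewrite (insubT (fun m => m < t) it) /=.
have /and3P[eE v1 v2] := P (Ordinal it); split=> //.
  by rewrite (_ : inord i = widen_ord (leqnSn t) (Ordinal it)) //;
     apply/val_inj; rewrite /= inordK // ltnW.
by rewrite (_ : inord i.+1 = lift ord0 (Ordinal it)) //;
   apply/val_inj; rewrite /= inordK.
Qed.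

(** [kappa] collects indices on the path, [nbhd] vertices anywhere; maximality places every free
    neighbour of [v 0] on the path. *)
Lemma kappa_card (V : finType) (E : {set {set V}}) t v e :
  (forall v' e', ~ bpath E t.+1 v' e') -> bpath E t v e ->
  #|kappa E [ffun i : 'I_t.+1 => v i] [ffun i : 'I_t => e i] ord0| =
  #|nbhd E (edge_set t e) (v 0)|.
Proof.
move=> maxE P; have [vI _ _] := P.
have pe : path_edges [ffun i : 'I_t => e i] = edge_set t e.
  by apply: eq_imset => i; rewrite ffunE.
rewrite -(card_in_imset (f := fun i : 'I_t.+1 => v i)); last first.
  by move=> i j _ _ /vI H; apply/val_inj/H; rewrite -ltnS ltn_ord.
apply: eq_card => y; rewrite [y \in nbhd _ _ _]inE.
apply/imsetP/idP => [[i]|H].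
  by rewrite inE !ffunE pe in_setD1 => /andP[/andP[vi _] H] ->; rewrite vi.
have yN : y \in nbhd E (edge_set t e) (v 0) by rewrite inE.
have /nbhdP[_ [f [fE fP v0f yf]]] := yN.
have [i it defy] := free_edge_in_keys maxE P fE fP v0f yf.
exists (inord i); last by rewrite inordK.
rewrite inE !ffunE pe inordK // -defy in_setD1.
case/andP: H => -> ->; rewrite andbT /=.
by apply/imsetP; exists (inord i); rewrite // ffunE inordK.
Qed.

(** Membership in [U] is carried along a Berge path edge by edge. Connectivity enters the argument
    only in this form. *)
Lemma connected_closed (V : finType) (E : {set {set V}}) (U : {set V}) :
  connected E -> U != set0 ->
  (forall f x, f \in E -> x \in f -> x \in U -> f \subset U) -> U = setT.
Proof.
move=> cE /set0Pn[x xU] closU; apply/setP=> y; rewrite in_setT.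
have [t [v [e [/berge_bpath[_ _ P] v0 vt]]]] := cE x y.
have vU i : i <= t -> v (inord i) \in U.
  elim: i => [_|i IH it]; first by rewrite (_ : inord 0 = ord0) ?v0 //;
    apply/val_inj; rewrite /= inordK.
  have [eE v1 v2] := P i it.
  exact: (subsetP (closU _ _ eE v1 (IH (ltnW it)))).
by have := vU t (leqnn t); rewrite (_ : inord t = ord_max) ?vt //;
   apply/val_inj; rewrite /= inordK.
Qed.

Theorem theorem3p2 (k r n d : nat) (V : finType) (E : {set {set V}})
  (hr : 2 <= r) (hk : r <= k) (hn : 2 * k + 1 < n)
  (hd : d = 'C(k, r - 1) \/ d = 'C(k, r - 1) + 1)
  (hV : #|V| = n) (hE : uniform r E)
  (hconn : connected E) (hdeg : d <= min_degree E)
  (hell : ell E = 2 * k)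
  (hkappa : forall (v : {ffun 'I_(2 * k).+1 -> V})
                   (e : {ffun 'I_(2 * k) -> {set V}}),
      berge_path E v e ->
      #|kappa E v e ord0| = k /\ #|kappa E v e ord_max| = k) :
  d = 'C(k, r - 1) /\
  ((exists2 f : V -> 'I_k + 'I_(n - k), bijective f &
      (Sgraph' r n k \subset relabel f E) && (relabel f E \subset Sgraph r n k))
   \/
   (exists2 s : nat, n = s * k + 1 & isomorphic E (clique_star r s k))).
Proof.
have maxE v e : ~ bpath E (2 * k).+1 v e.
  by move=> /bpath_berge/leq_ell; rewrite hell ltnn.
have kapE v e : bpath E (2 * k) v e -> #|nbhd E (edge_set (2 * k) e) (v 0)| = k.
  by move=> P; rewrite -(kappa_card maxE P); have [] := hkappa _ _ (bpath_berge P).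
have bigV : 2 * k + 1 < #|V| by rewrite hV.
have dE x : d <= degree E x by apply: leq_trans (min_degree_le E x).
rewrite subn1 in hd *.
have degE x : 'C(k, r.-1) <= degree E x.
  by apply: leq_trans (dE x); case: hd => ->; rewrite ?leq_addr.
have connE U := @connected_closed V E U hconn.
have : has_path_of_length E (2 * k).
  by rewrite -hell; apply: ell_attained; apply: leq_ltn_trans bigV.
case/existsP=> v0 /existsP[e0 /berge_bpath P].
have [_ _ deg0] := start_link hr hk hE degE bigV connE maxE kapE P.
split.
  (* The start of a longest path has degree exactly C(k,r-1), which excludes the larger [d]. *)
  case: hd => // hd; have := dE (v0 (inord 0)).
  by rewrite deg0 hd addn1 ltnn.
have k0 : 0 < k by apply: leq_trans hk; apply: ltnW.
case: (extremal_structure hr hk hE degE bigV connE maxE kapE P) => [[A cA HA]|[c Hc]].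
  by left; rewrite -hV; apply: split_iso cA HA.
by right; rewrite -hV; apply: star_iso k0 Hc.
Qed.
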